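(* Let $g\ge1$ be an integer, $\rho:=2g-2$, let $n$ be a positive integer and $\lambda=(\lambda_1,\lambda_2,\ldots)$ a non-zero partition. Define $n\lambda:=(n\lambda_1,n\lambda_2,\ldots)$. Then $$ A_{n\lambda}^{\rho}(q)=A_\lambda^{n\rho}(q). $$ In particular, for the partition $(n)$ with the single part $n$, $$ A^{\rho}_{(n)}(q)=q^{n(g-1)+1}. $$
   Context: Let $g\ge 1$ be an integer and $\rho=2g-2$. For a finite sequence $m=(m_1,\ldots,m_N)$ of non-negative integers and variables $x=(x_1,\ldots,x_N)$ put $x^m:=x_1^{m_1}\cdots x_N^{m_N}$, $(q)_n:=\prod_{k=1}^n(1-q^k)$ (so $(q^{-1})_n=\prod_{k=1}^n(1-q^{-k})$), and $(q^{-1})_m:=\prod_{i=1}^N (q^{-1})_{m_i}$. Let $\mathcal H_N$ be the $N\times N$ matrix with entries $\min(i,j)$, $1\le i,j\le N$. Define $$ \mathrm{Hua}_N(x;q):=\sum_{m\in\mathbb Z_{\ge0}^N}\frac{q^{(g-1)\,{}^tm\mathcal H_N m}}{(q^{-1})_m}\,x^m\in 1+(x_1,\dots,x_N)\,\mathbb Q(q)[[x_1,\ldots,x_N]]. $$ $\mathrm{Log}$ denotes the plethystic logarithm: for a power series $F$ over $\mathbb Q(q)$ with constant term $1$, $\mathrm{Log}(F):=\sum_{k\ge1}\frac{\mu(k)}{k}\,\psi_k(\log F)$, where $\mu$ is the Möbius function and $\psi_k$ replaces $q$ by $q^k$ and each $x_i$ by $x_i^k$; it takes products to sums and sends $(1-w)^{-1}$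 to $w$ for a non-constant monomial $w$. The rational functions $A_m(q)\in\mathbb Q(q)$ are defined by $$ (q-1)\,\mathrm{Log}\big(\mathrm{Hua}_N(x;q)\big)=\sum_m A_m(q)\,x^m . $$ For a partition $\lambda=(1^{m_1}2^{m_2}\cdots N^{m_N})$ (i.e. $\lambda$ has exactly $m_i$ parts equal to $i$, and all parts are $\le N$) set $A_\lambda(q):=A_m(q)$, with $m=(m_1,\ldots,m_N)$; this does not depend on the choice of $N\ge\lambda_1$, where $\lambda_1$ is the largest part. One writes $A_\lambda^{\rho}(q)$ for $A_\lambda(q)$ to indicate the dependence on $g$ through $\rho=2g-2$; thus $A_\lambda^{n\rho}$ is the rational function obtained with $g$ replaced by $n(g-1)+1$. *)

(* Defs.v *)
From HB Require Import structures.
From mathcomp Require Import all_boot all_order all_algebra.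
From mathcomp Require Import mpoly.

Set Implicit Arguments.
Unset Strict Implicit.
Unset Printing Implicit Defensive.

Import Order.TTheory GRing.Theory Num.Theory.
Local Open Scope ring_scope.

(* The field Q(q). *)
Definition Qq : fieldType := {fraction {poly rat}}.

Definition q : Qq := FracField.tofrac ('X : {poly rat}).

(* (x)_n = (1 - x)(1 - x^2)...(1 - x^n); it is used at x = q^-1. *)
Definition qpoch (x : Qq) (n : nat) : Qq := \prod_(1 <= k < n.+1) (1 - x ^+ k).

(* The formal power series ring Q(q)[[x_1, ..., x_N]]: a series is the family
   of its coefficients.  Index i : 'I_N stands for the variable x_(i+1). *)
Definition series (N : nat) : Type := 'X_{1..N} -> Qq.

Section PowerSeries.
Variable N : nat.
Implicit Types (F G : series N) (m : 'X_{1..N}).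

Definition one_series : series N := fun m => (m == 0%MM)%:R.

Definition sub_series F G : series N := fun m => F m - G m.

(* The degree bound only makes the index type finite, as in mcoeffM. *)
Definition mul_series F G : series N := fun m =>
  \sum_(k : 'X_{1..N < (mdeg m).+1, (mdeg m).+1} | m == (k.1 + k.2)%MM)
     F k.1 * G k.2.

Definition exp_series F (k : nat) : series N := iter k (mul_series F) one_series.

(* log F = \sum_(k >= 1) (-1)^(k-1) / k (F - 1)^k, for F of constant term 1.
   The coefficient at m of (F - 1)^k vanishes for k > mdeg m: see
   exp_series_lowdeg. *)
Definition log_series F : series N := fun m =>
  \sum_(1 <= k < (mdeg m).+1)
     (-1) ^+ k.-1 / k%:R * exp_series (sub_series F one_series) k m.

End PowerSeries.

(* p(q)/d(q) |-> p(q^k)/d(q^k), for k >= 1; independent of the chosen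
   representative: see adams_fracE. *)
Definition adams_frac (k : nat) (f : Qq) : Qq :=
  FracField.tofrac (\n_(repr f) \Po 'X^k) /
  FracField.tofrac (\d_(repr f) \Po 'X^k).

(* psi_k: q |-> q^k and x_i |-> x_i^k, for k >= 1. *)
Definition adams N (k : nat) (F : series N) : series N := fun m =>
  if [forall i, k %| m i]%N
  then adams_frac k (F [multinom (m i %/ k)%N | i < N])
  else 0.

Definition moebius (k : nat) : Qq :=
  if all (fun p => logn p k == 1%N) (primes k)
  then (-1) ^+ size (primes k) else 0.

(* Log F = \sum_(k >= 1) mu(k) / k psi_k (log F).  The coefficient at m of
   psi_k (log F) vanishes for k > mdeg m: see adams_log_lowdeg. *)
Definition plog N (F : series N) : series N := fun m =>
  \sum_(1 <= k < (mdeg m).+1) moebius k / k%:R * adams k (log_series F) m.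

Definition minform N (m : 'X_{1..N}) : nat :=
  \sum_(i < N) \sum_(j < N) m i * minn i.+1 j.+1 * m j.

(* For g >= 1 the exponent of q is a natural number. *)
Definition Hua (g N : nat) : series N := fun m =>
  q ^+ ((g - 1) * minform m) / \prod_(i < N) qpoch q^-1 (m i).

Definition Acoef (g N : nat) (m : 'X_{1..N}) : Qq :=
  (q - 1) * plog (@Hua g N) m.

(* A partition is the weakly decreasing sequence of its positive parts. *)
Definition is_partition (lam : seq nat) : bool :=
  sorted geq lam && (0 \notin lam)%N.

Definition mults (N : nat) (lam : seq nat) : 'X_{1..N} :=
  [multinom count_mem i.+1 lam | i < N].

(* Computed with N = lam_1; every larger N gives the same value: see
   Apart_indep. *)
Definition Apart (g : nat) (lam : seq nat) : Qq :=
  Acoef g (mults (head 0%N lam) lam).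

Definition scale_part (n : nat) (lam : seq nat) : seq nat :=
  [seq (n * l)%N | l <- lam].

Section Checks.

Lemma exp_series_lowdeg N (F : series N) k m :
  F 0%MM = 0 -> (mdeg m < k)%N -> exp_series F k m = 0.
Proof.
move=> F0; elim: k m => // k IH m ltmk.
rewrite /exp_series iterS -/(exp_series F k) /mul_series big1 // => -[a b] /= /eqP em.
case: (eqVneq (bmnm a) 0%MM) => [->|nza]; first by rewrite F0 mul0r.
rewrite IH ?mulr0 //.
have : (0 < mdeg a)%N by rewrite lt0n mdeg_eq0.
have := congr1 mdeg em; rewrite mdegD => E; rewrite E in ltmk => h.
by rewrite -ltnS; apply: leq_trans ltmk; rewrite ltnS -addn1 addnC leq_add2r.
Qed.

Lemma log_series0 N (F : series N) : log_series F 0%MM = 0.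
Proof. by rewrite /log_series mdeg0 big_geq. Qed.

Lemma comp_Xn_neq0 (k : nat) (p : {poly rat}) :
  (0 < k)%N -> p != 0 -> p \Po 'X^k != 0.
Proof.
move=> k0 p0; rewrite -lead_coef_eq0 lead_coef_comp ?size_polyXn ?ltnS //.
by rewrite lead_coefXn expr1n mulr1 lead_coef_eq0.
Qed.

Lemma adams_fracE (k : nat) (p d : {poly rat}) :
  (0 < k)%N -> d != 0 ->
  adams_frac k (FracField.tofrac p / FracField.tofrac d) =
  FracField.tofrac (p \Po 'X^k) / FracField.tofrac (d \Po 'X^k).
Proof.
move=> k0 d0; set f := (_ / _ : {fraction {poly rat}}).
have fE : f = FracField.tofrac \n_(repr f) / FracField.tofrac \d_(repr f).
  rewrite -[LHS]reprK; set r := repr f.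
  apply: (canRL (mulfK _)); first by rewrite tofrac_eq0 denom_ratioP.
  rewrite [FracField.tofrac \d_r]piE [FracField.tofrac \n_r]piE.
  rewrite -[LHS]/(FracField.mul _ _) -FracField.pi_mul.
  apply/eqP; rewrite FracField.equivf_def /FracField.mulf.
  rewrite !numden_Ratio ?oner_eq0 ?mulr1 ?denom_ratioP //.
  by rewrite mulrC.
have dr := denom_ratioP (repr f).
have/eqP: f = f by [].
rewrite {1}fE {1}/f eqr_div ?tofrac_eq0 // -!tofracM tofrac_eq => /eqP E.
rewrite /adams_frac; apply/eqP.
rewrite eqr_div ?tofrac_eq0 ?comp_Xn_neq0 // -!tofracM tofrac_eq.
by rewrite -!comp_polyM E.
Qed.

Lemma adams_frac0 k : (0 < k)%N -> adams_frac k 0 = 0.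
Proof.
move=> k0; have := @adams_fracE k 0 1 k0 (oner_neq0 _).
by rewrite comp_poly0 !tofrac0 !mul0r.
Qed.

Lemma adams_log_lowdeg N (F : series N) k m :
  (0 < k)%N -> m != 0%MM -> (mdeg m < k)%N -> adams k (log_series F) m = 0.
Proof.
move=> k0 m0 ltmk; rewrite /adams; case: ifP => // /forallP kdv.
case/eqP: m0; apply/mnmP => i; rewrite mnm0E; apply/eqP.
case: (posnP (m i)) => // mi0; have := dvdn_leq mi0 (kdv i).
by rewrite leqNgt (leq_ltn_trans _ ltmk) // mdegE (bigD1 i) //= leq_addr.
Qed.

Lemma adams_log0 N (F : series N) k :
  (0 < k)%N -> adams k (log_series F) 0%MM = 0.
Proof.
move=> k0; rewrite /adams; case: ifP => // _.
rewrite (_ : [multinom _ | i < N] = 0%MM) ?log_series0 ?adams_frac0 //.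
by apply/mnmP => i; rewrite mnmE !mnm0E div0n.
Qed.

Lemma Hua0 g N : @Hua g N 0%MM = 1.
Proof.
rewrite /Hua /minform big1 => [|i _]; last first.
  by rewrite big1 // => j _; rewrite mnm0E.
rewrite muln0 expr0 big1 ?divr1 // => i _.
by rewrite mnm0E /qpoch big_geq.
Qed.

(* Setting the superfluous variables to zero. *)
Definition pad N0 N (m : 'X_{1..N0}) : 'X_{1..N} :=
  [multinom nth 0%N m i | i < N].

Lemma big_pad (R : Type) (idx : R) (op : Monoid.com_law idx) N0 N
    (H : nat -> nat -> R) (m : 'X_{1..N0}) :
  (N0 <= N)%N -> (forall i, H i 0%N = idx) ->
  \big[op/idx]_(i < N) H i (pad N m i) = \big[op/idx]_(i < N0) H i (m i).
Proof.
move=> le H0.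
transitivity (\big[op/idx]_(i < N) H i (nth 0%N m i)).
  by apply: eq_bigr => i _; rewrite mnmE.
rewrite -(big_mkord xpredT (fun i => H i (nth 0%N m i))).
rewrite (@big_cat_nat _ _ _ N0) //= [X in op _ X]big_nat_cond.
rewrite [X in op _ X]big1 => [|i /andP[/andP[h _] _]]; last first.
  by rewrite nth_default ?H0 // size_tuple.
rewrite Monoid.mulm1 big_mkord; apply: eq_bigr => i _.
by rewrite (mnm_nth 0%N).
Qed.

Section Pad.
Variables (N0 N : nat).
Hypothesis leN : (N0 <= N)%N.
Local Notation pd := (@pad N0 N).

Lemma mdeg_pad m : mdeg (pd m) = mdeg m.
Proof. by rewrite !mdegE (@big_pad _ _ _ _ _ (fun _ x => x)). Qed.

Lemma pad_widen m (i : 'I_N0) : pd m (widen_ord leN i) = m i.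
Proof. by rewrite mnmE (mnm_nth 0%N). Qed.

Lemma padK : cancel pd (@pad N N0).
Proof.
move=> m; apply/mnmP => i; rewrite mnmE.
by rewrite -[RHS]pad_widen (mnm_nth 0%N).
Qed.

Lemma pad_out m (i : 'I_N) : (N0 <= i)%N -> pd m i = 0%N.
Proof. by move=> h; rewrite mnmE nth_default // size_tuple. Qed.

Lemma padD a b : pd (a + b)%MM = (pd a + pd b)%MM.
Proof.
apply/mnmP => i; rewrite mnmDE; case: (ltnP i N0) => hi.
  have -> : i = widen_ord leN (Ordinal hi) by apply: val_inj.
  by rewrite !pad_widen mnmDE.
by rewrite !pad_out.
Qed.

Lemma padKV (a : 'X_{1..N}) :
  (forall i : 'I_N, (N0 <= i)%N -> a i = 0%N) -> pd (pad N0 a) = a.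
Proof.
move=> h; apply/mnmP => i; case: (ltnP i N0) => hi; last by rewrite pad_out ?h.
have -> : i = widen_ord leN (Ordinal hi) by apply: val_inj.
by rewrite pad_widen mnmE (mnm_nth 0%N).
Qed.

Lemma pad0 : pd 0%MM = 0%MM.
Proof. by apply/eqP; rewrite -mdeg_eq0 mdeg_pad mdeg0. Qed.

Lemma mul_series_pad (F G : series N) (F0 G0 : series N0) m :
  (forall m, F (pd m) = F0 m) -> (forall m, G (pd m) = G0 m) ->
  mul_series F G (pd m) = mul_series F0 G0 m.
Proof.
move=> hF hG; rewrite /mul_series; set d := (mdeg m).+1.
have dE : (mdeg (pd m)).+1 = d by rewrite mdeg_pad.
rewrite dE.
have ltd (a : 'X_{1..N0 < d}) : (mdeg (pd a) < d)%N by rewrite mdeg_pad bmdeg.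
pose up (a : 'X_{1..N0 < d}) := BMultinom (ltd a).
pose dn (a : 'X_{1..N < d}) : 'X_{1..N0 < d} := insubd bm0 (pad N0 a).
have dnK (a : 'X_{1..N < d}) :
    (forall i : 'I_N, (N0 <= i)%N -> (bmnm a) i = 0%N) -> up (dn a) = a.
  move=> h; apply: val_inj => /=; rewrite /dn val_insubd.
  by rewrite -mdeg_pad padKV // bmdeg padKV.
have upK : cancel up dn.
  move=> a; apply: val_inj; rewrite /dn val_insubd /= padK.
  by rewrite bmdeg.
rewrite (reindex_onto (fun k => (up k.1, up k.2)) (fun k => (dn k.1, dn k.2))) /=.
  apply: eq_big => [[a b]|[a b] _] /=; last by rewrite hF hG.
  rewrite !upK eqxx andbT -padD; apply/eqP/eqP => [|->//].
  exact: (can_inj padK).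
move=> [a b] /= /eqP /mnmP E; rewrite !dnK // => i hi;
  have := E i; rewrite pad_out // mnmDE => /esym/eqP;
  by rewrite addn_eq0 => /andP[/eqP ? /eqP ?].
Qed.

Lemma one_series_pad m : one_series (pd m) = one_series m.
Proof. by rewrite /one_series -!mdeg_eq0 mdeg_pad. Qed.

Lemma log_series_pad (F : series N) (F0 : series N0) m :
  (forall m, F (pd m) = F0 m) -> log_series F (pd m) = log_series F0 m.
Proof.
move=> hF; rewrite /log_series mdeg_pad; apply: eq_bigr => k _; congr (_ * _).
elim: k m => [|k IH] m; first exact: one_series_pad.
rewrite /exp_series !iterS; apply: mul_series_pad => // a.
by rewrite /sub_series hF one_series_pad.
Qed.

Lemma adams_pad k (F : series N) (F0 : series N0) m :
  (forall m, F (pd m) = F0 m) -> adams k F (pd m) = adams k F0 m.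
Proof.
move=> hF; rewrite /adams.
have -> : [forall i, k %| pd m i]%N = [forall i, k %| m i]%N.
  apply/forallP/forallP => h i.
    by rewrite -pad_widen.
  case: (ltnP i N0) => hi; last by rewrite pad_out.
  have -> : i = widen_ord leN (Ordinal hi) by apply: val_inj.
  by rewrite pad_widen.
case: ifP => // _; rewrite -hF; congr (adams_frac _ (F _)).
apply/mnmP => i; rewrite mnmE; case: (ltnP i N0) => hi.
  have -> : i = widen_ord leN (Ordinal hi) by apply: val_inj.
  by rewrite !pad_widen mnmE.
by rewrite !pad_out // div0n.
Qed.

Lemma plog_pad (F : series N) (F0 : series N0) m :
  (forall m, F (pd m) = F0 m) -> plog F (pd m) = plog F0 m.
Proof.
move=> hF; rewrite /plog mdeg_pad; apply: eq_bigr => k _; congr (_ * _).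
by apply: adams_pad => a; exact: log_series_pad.
Qed.

Lemma Hua_pad g m : Hua g (pd m) = Hua g m.
Proof.
rewrite /Hua; congr (_ ^+ (_ * _) / _); last first.
  by rewrite (@big_pad _ _ _ _ _ (fun _ a => qpoch q^-1 a)) // => i; rewrite /qpoch big_geq.
rewrite /minform.
rewrite (@big_pad _ _ _ _ _ (fun i a => \sum_(j < N) a * minn i.+1 j.+1 * pd m j)%N) //.
  apply: eq_bigr => i _.
  by rewrite (@big_pad _ _ _ _ _ (fun j b => m i * minn i.+1 j.+1 * b)%N) // => j; rewrite muln0.
by move=> i; rewrite big1 // => j _; rewrite mul0n.
Qed.

End Pad.

Lemma Apart_indep g N lam :
  is_partition lam -> (head 0 lam <= N)%N -> Acoef g (mults N lam) = Apart g lam.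
Proof.
move=> /andP[hs _] hN; rewrite /Apart /Acoef; congr (_ * _).
rewrite -(plog_pad hN (F := @Hua g N)); last by move=> m; exact: Hua_pad.
congr plog; apply/mnmP => i; rewrite mnmE.
case: (ltnP i (head 0%N lam)) => hi.
  have -> : i = widen_ord hN (Ordinal hi) by apply: val_inj.
  by rewrite pad_widen mnmE.
rewrite pad_out //; apply/count_memPn; apply/negP.
case: lam hs hi {hN} => //= a l hs hi; rewrite inE => /orP[/eqP E|].
  by rewrite -E ltnn in hi.
have := order_path_min (rev_trans leq_trans) hs => /allP h /h /=.
by move=> h1; have := leq_trans h1 hi; rewrite ltnn.
Qed.

End Checks.

(* Main.v *)
(* Setting to zero the variables whose index is not a multiple of [n] commutes
   with the plethystic logarithm.  On the remaining variables the quadratic form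
   is multiplied by [n], as [min (n i, n j) = n min (i, j)], so the restricted
   series is that of the genus [n (g - 1) + 1].  For the partition [(n)] this
   reduces the claim to the linear coefficient in one variable. *)
Require Import Defs.
From mathcomp Require Import all_boot all_order all_algebra.
From mathcomp Require Import mpoly.
Import GRing.Theory.
Local Open Scope ring_scope.

Set Implicit Arguments.
Unset Strict Implicit.
Unset Printing Implicit Defensive.

Section Reindexing.
Variables (N0 N : nat) (f : 'I_N0 -> 'I_N).
Hypothesis f_inj : injective f.

(** For injective [f] each sum has at most one term, so this is extension by zero along [f]; written
    as a sum over fibres, it is visibly additive in [m]. *)
Definition mpush (m : 'X_{1..N0}) : 'X_{1..N} :=
  [multinom (\sum_(i < N0 | f i == j) m i)%N | j < N].

Definition mpull (a : 'X_{1..N}) : 'X_{1..N0} := [multinom a (f i) | i < N0].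

Lemma mpush_in m i : mpush m (f i) = m i.
Proof.
rewrite mnmE (big_pred1 i) // => k.
by rewrite (inj_eq f_inj).
Qed.

Lemma mpush_out m j : j \notin codom f -> mpush m j = 0%N.
Proof.
move=> hj; rewrite mnmE big_pred0 // => k.
by apply: contraNF hj => /eqP <-; exact: codom_f.
Qed.

(** Indices outside the image of [f] contribute the neutral element, and injectivity reindexes the
    rest. This serves degrees, the Pochhammer product and the quadratic form alike. *)
Lemma big_mpush (R : Type) (idx : R) (op : Monoid.com_law idx)
    (H : 'I_N -> nat -> R) m :
  (forall j, H j 0%N = idx) ->
  \big[op/idx]_(j < N) H j (mpush m j) = \big[op/idx]_(i < N0) H (f i) (m i).
Proof.
move=> H0; rewrite (bigID (fun j => j \in codom f)) /= [X in op _ X]big1 => [|j hj]; last first.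
  by rewrite mpush_out.
rewrite Monoid.mulm1 (eq_bigl (fun j => j \in f @: [set: 'I_N0])) => [|j]; last first.
  by apply/codomP/imsetP => [[i ->]|[i _ ->]]; exists i.
rewrite big_imset /= => [|? ? _ _]; last exact: f_inj.
by apply: eq_big => [i|i _]; rewrite ?inE ?mpush_in.
Qed.

Lemma mdeg_mpush m : mdeg (mpush m) = mdeg m.
Proof. by rewrite !mdegE (@big_mpush _ _ _ (fun _ x => x)). Qed.

Lemma mpushK : cancel mpush mpull.
Proof. by move=> m; apply/mnmP => i; rewrite mnmE mpush_in. Qed.

Lemma mpushD a b : mpush (a + b)%MM = (mpush a + mpush b)%MM.
Proof.
by apply/mnmP => j; rewrite mnmDE !mnmE -big_split; apply: eq_bigr => i _; rewrite mnmDE.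
Qed.

Lemma mpullK (a : 'X_{1..N}) : (forall j, j \notin codom f -> a j = 0%N) -> mpush (mpull a) = a.
Proof.
move=> h; apply/mnmP => j; case: (boolP (j \in codom f)) => [/codomP[i ->]|hj].
  by rewrite mpush_in mnmE.
by rewrite mpush_out ?h.
Qed.

Lemma one_series_mpush m : one_series (mpush m) = one_series m.
Proof. by rewrite /one_series -!mdeg_eq0 mdeg_mpush. Qed.

(** Both summands of a decomposition of [mpush m] are supported on the image of [f], so these
    decompositions correspond bijectively to those of [m]. *)
Lemma mul_series_mpush (F G : series N) (F0 G0 : series N0) m :
  (forall m, F (mpush m) = F0 m) -> (forall m, G (mpush m) = G0 m) ->
  mul_series F G (mpush m) = mul_series F0 G0 m.
Proof.
move=> hF hG; rewrite /mul_series mdeg_mpush; set d := (mdeg m).+1.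
have ltd (a : 'X_{1..N0 < d}) : (mdeg (mpush a) < d)%N by rewrite mdeg_mpush bmdeg.
pose up (a : 'X_{1..N0 < d}) := BMultinom (ltd a).
(* The default [bm0] is not reached for exponents supported on the image of [f], since [mpull]
   preserves their degree. *)
pose dn (a : 'X_{1..N < d}) : 'X_{1..N0 < d} := insubd bm0 (mpull a).
have dnK (a : 'X_{1..N < d}) :
    (forall j, j \notin codom f -> bmnm a j = 0%N) -> up (dn a) = a.
  move=> h; apply: val_inj => /=; rewrite /dn val_insubd.
  by rewrite -mdeg_mpush mpullK // bmdeg mpullK.
have upK : cancel up dn.
  by move=> a; apply: val_inj; rewrite /dn val_insubd /= mpushK bmdeg.
rewrite (reindex_onto (fun k => (up k.1, up k.2)) (fun k => (dn k.1, dn k.2))) /=.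
  apply: eq_big => [[a b]|[a b] _] /=; last by rewrite hF hG.
  by rewrite !upK eqxx andbT -mpushD (can_eq mpushK).
move=> [a b] /= /eqP /mnmP E.
(* Natural numbers with sum zero both vanish. *)
have out j : j \notin codom f -> (bmnm a j == 0%N) && (bmnm b j == 0%N).
  by move=> hj; rewrite -addn_eq0 -mnmDE -E mpush_out.
by rewrite !dnK // => j /out /andP[/eqP ? /eqP ?].
Qed.

Lemma log_series_mpush (F : series N) (F0 : series N0) m :
  (forall m, F (mpush m) = F0 m) -> log_series F (mpush m) = log_series F0 m.
Proof.
move=> hF; rewrite /log_series mdeg_mpush; apply: eq_bigr => k _; congr (_ * _).
elim: k m => [|k IH] m; first exact: one_series_mpush.
rewrite /exp_series !iterS; apply: mul_series_mpush => // a.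
by rewrite /sub_series hF one_series_mpush.
Qed.

(** The added zero exponents are divisible by [k] with quotient zero, so they affect neither the
    divisibility test nor the divided exponent. *)
Lemma adams_mpush k (F : series N) (F0 : series N0) m :
  (forall m, F (mpush m) = F0 m) -> adams k F (mpush m) = adams k F0 m.
Proof.
move=> hF; rewrite /adams.
have -> : [forall j, k %| mpush m j]%N = [forall i, k %| m i]%N.
  apply/forallP/forallP => h i; first by rewrite -mpush_in.
  case: (boolP (i \in codom f)) => [/codomP[i0 ->]|hi]; first by rewrite mpush_in.
  by rewrite mpush_out.
case: ifP => // _; rewrite -hF; congr (adams_frac _ (F _)).
apply/mnmP => j; rewrite mnmE.
case: (boolP (j \in codom f)) => [/codomP[i ->]|hj].
  by rewrite !mpush_in mnmE.
by rewrite !mpush_out // div0n.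
Qed.

Lemma plog_mpush (F : series N) (F0 : series N0) m :
  (forall m, F (mpush m) = F0 m) -> plog F (mpush m) = plog F0 m.
Proof.
move=> hF; rewrite /plog mdeg_mpush; apply: eq_bigr => k _; congr (_ * _).
by apply: adams_mpush => a; exact: log_series_mpush.
Qed.

Lemma Hua_mpush n g m :
  (forall i, (f i).+1 = n * i.+1)%N ->
  Hua g (mpush m) = Hua (n * (g - 1) + 1) m.
Proof.
move=> fE; rewrite /Hua; congr (_ ^+ _ / _); last first.
  by rewrite (@big_mpush _ _ _ (fun _ a => qpoch q^-1 a)) // => j; rewrite /qpoch big_geq.
(* The new genus minus one is [n * (g - 1)]; its factor [n] is moved onto the quadratic form, whose
   two indices are then reindexed in turn. *)
rewrite addnK [(n * _)%N]mulnC -mulnA; congr (_ * _)%N; rewrite /minform.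
rewrite (@big_mpush _ _ _ (fun i a => \sum_(j < N) a * minn i.+1 j.+1 * mpush m j)%N);
  last by move=> j; rewrite big1.
rewrite big_distrr /=; apply: eq_bigr => i _.
rewrite (@big_mpush _ _ _ (fun j b => m i * minn (f i).+1 j.+1 * b)%N);
  last by move=> j; rewrite muln0.
rewrite big_distrr /=; apply: eq_bigr => j _.
by rewrite !fE -minnMr mulnCA -!mulnA.
Qed.

End Reindexing.

Section Scaling.
Variables (n N : nat).
Hypothesis hn : (0 < n)%N.

Lemma scale_ord_subproof (i : 'I_N) : ((n * i.+1).-1 < n * N)%N.
Proof. by rewrite prednK ?muln_gt0 ?hn // leq_pmul2l. Qed.

(* The variable [x_i] has index [i - 1], so [x_i |-> x_(n i)] reads as follows. *)
Definition scale_ord (i : 'I_N) : 'I_(n * N) := Ordinal (scale_ord_subproof i).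

Lemma scale_ordS i : (scale_ord i).+1 = (n * i.+1)%N.
Proof. by rewrite /= prednK // muln_gt0 hn. Qed.

Lemma scale_ord_inj : injective scale_ord.
Proof.
move=> i j E; apply/val_inj/eqP; rewrite -eqSS -(eqn_pmul2l hn).
by rewrite -!scale_ordS E.
Qed.

Lemma mults_scale lam :
  0%N \notin lam -> mults (n * N) (scale_part n lam) = mpush scale_ord (mults N lam).
Proof.
move=> lam0; apply/mnmP => j; case: (boolP (j \in codom scale_ord)).
  case/codomP=> i ->; rewrite (mpush_in scale_ord_inj) !mnmE scale_ordS count_map.
  by apply: eq_count => l /=; rewrite eqn_pmul2l.
move=> hj; rewrite mpush_out // mnmE; apply/count_memPn.
apply: contraNN hj => /mapP[l hl jE].
(* Positivity of the part [l] gives it a variable, of index [l.-1]; its image under [scale_ord] is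
   [j]. *)
have l0 : (0 < l)%N by rewrite lt0n; apply: contraNneq lam0 => <-.
have lN : (l.-1 < N)%N by rewrite prednK // -(leq_pmul2l hn) -jE.
apply/codomP; exists (Ordinal lN); apply/val_inj/succn_inj.
by rewrite scale_ordS /= prednK.
Qed.

End Scaling.

Lemma Apart_scale g n lam :
  (0 < n)%N -> 0%N \notin lam ->
  Apart g (scale_part n lam) = Apart (n * (g - 1) + 1) lam.
Proof.
move=> hn lam0; rewrite /Apart.
(* The numbers of variables on the two sides are thus exactly those related by [scale_ord]. *)
have -> : head 0%N (scale_part n lam) = (n * head 0%N lam)%N.
  by case: lam {lam0} => //=; rewrite muln0.
rewrite mults_scale // /Acoef; congr (_ * _).
apply: (plog_mpush (@scale_ord_inj _ _ hn)) => m.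
exact: (Hua_mpush (@scale_ord_inj _ _ hn) g m (scale_ordS hn)).
Qed.

Lemma adams_frac1 x : adams_frac 1 x = x.
Proof.
rewrite /adams_frac expr1 !comp_polyXr -[RHS]reprK; set r := repr x.
apply/esym/(canRL (mulfK _)); first by rewrite tofrac_eq0 denom_ratioP.
rewrite [FracField.tofrac \d_r]piE [FracField.tofrac \n_r]piE.
rewrite -[LHS]/(FracField.mul _ _) -FracField.pi_mul.
apply/eqP; rewrite FracField.equivf_def /FracField.mulf.
by rewrite !numden_Ratio ?oner_eq0 ?mulr1 ?denom_ratioP // mulrC.
Qed.

Lemma mul_series1 N (F : series N) m : mul_series F (@one_series N) m = F m.
Proof.
rewrite /mul_series (bigD1 (BMultinom (ltnSn (mdeg m)), bm0)) /= ?addm0 //.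
rewrite /one_series eqxx mulr1 big1 ?addr0 // => -[a b] /= /andP[/eqP E ne].
case: eqP => [b0|_]; last by rewrite mulr0.
case/eqP: ne; congr pair; apply: val_inj => //=.
by rewrite [RHS]E b0 addm0.
Qed.

(** In degree one the sums defining [plog] and [log_series] both stop at [k = 1], where the Adams
    operation is the identity and the logarithm is [F - 1]. *)
Lemma plog_deg1 N (F : series N) m : mdeg m = 1%N -> plog F m = F m.
Proof.
move=> m1; rewrite /plog m1 big_nat1 /moebius /= expr0 !divr1 mul1r /adams.
rewrite (_ : [forall i, _]); last by apply/forallP => i; exact: dvd1n.
rewrite adams_frac1 (_ : [multinom _ | i < N] = m); last first.
  by apply/mnmP => i; rewrite mnmE divn1.
rewrite /log_series m1 big_nat1 expr0 divr1 mul1r /exp_series /= mul_series1.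
by rewrite /sub_series /one_series -mdeg_eq0 m1 subr0.
Qed.

Lemma Apart1 g : Apart g [:: 1%N] = q ^+ (g - 1).+1.
Proof.
rewrite /Apart /Acoef plog_deg1; last by rewrite mdegE big_ord1 mnmE.
rewrite /Hua /minform !big_ord1 !mnmE /= !muln1 /qpoch big_nat1 expr1 exprS.
have q0 : q != 0 by rewrite tofrac_eq0 polyX_eq0.
have q1 : q - 1 != 0.
  by rewrite -tofrac1 -tofracB tofrac_eq0 -size_poly_eq0 -polyC1 size_XsubC.
(* The prefactor [q - 1] cancels against this denominator, leaving one extra factor [q]. *)
have -> : 1 - q^-1 = (q - 1) / q by rewrite mulrBl divff // mul1r.
by rewrite invf_div mulrCA [(q - 1) * _]mulrC divfK // mulrC.
Qed.

Theorem proposition1p0p4 (g n : nat) (hg : (1 <= g)%N) (hn : (0 < n)%N) :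
  (forall lam : seq nat, is_partition lam -> lam <> [::] ->
     Apart g (scale_part n lam) = Apart (n * (g - 1) + 1) lam)
  /\ Apart g [:: n] = q ^+ (n * (g - 1) + 1).
Proof.
split=> [lam /andP[_ lam0] _|]; first exact: Apart_scale.
(* The partition [[:: n]] is [[:: 1]] scaled by [n]. *)
have := @Apart_scale g n [:: 1%N] hn isT; rewrite /= muln1 => ->.
by rewrite Apart1 addnK addn1.
Qed.
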